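(* Let $q$ be a positive real number with $q\neq 1$ and let $f_q:(0,1]\to\mathbb{R}$ be a differentiable nonnegative function satisfying the functional equation $$f_q(xy)=x^{q}f_q(y)+y\,f_q(x)\qquad\text{for all } 0<x,y\le 1.$$ Then there is a nonnegative constant $c_q$ (depending only on the parameter $q$, i.e. not on $x$) such that $$f_q(x)=-c_q\,x^{q}\ln_q x\qquad\text{for all } x\in(0,1].$$
   Context: For $q\neq 1$ and $x>0$, the $q$-logarithm is defined by $\ln_q x=\dfrac{x^{1-q}-1}{1-q}$. Differentiability on $(0,1]$ is understood as one-sided (left) differentiability at the endpoint $1$. *)

(* Defs.v *)
From Stdlib Require Import Reals.
Local Open Scope R_scope.

(* The q-logarithm; meaningful only for q <> 1 and 0 < x. *)
Definition lnq (q x : R) : R := (Rpower x (1 - q) - 1) / (1 - q).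

Definition Ioc01 (x : R) : Prop := 0 < x <= 1.

(* Differentiability relative to the domain D: in [D_in] the difference
   quotient at x is taken over the points of D other than x.  On (0, 1] this is
   ordinary differentiability at interior points and left differentiability
   at 1, and it does not depend on the values of f outside D. *)
Definition differentiable_on (f : R -> R) (D : R -> Prop) : Prop :=
  exists f' : R -> R, forall x : R, D x -> D_in f f' D x.

(* Main.v *)
(** Exchanging x and y in the functional equation gives
    [f x * (y^q - y) = f y * (x^q - x)], so f is a multiple of
    [x^q - x = - x^q (x^(1-q) - 1)]; the constant is read off at [x = 1/2], where
    [x^q - x] is nonzero and has the sign of [1 - q]. *)
Require Import Defs.
From Stdlib Require Import Reals Lra.
Local Open Scope R_scope.

Lemma Rpower_lnq (q x : R) : q <> 1 -> 0 < x ->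
  Rpower x q * lnq q x = (x - Rpower x q) / (1 - q).
Proof.
intros hq hx; unfold lnq.
assert (h : Rpower x q * Rpower x (1 - q) = x).
{ rewrite <- Rpower_plus.
  replace (q + (1 - q)) with 1 by ring.
  now apply Rpower_1. }
(* Occurrence 3 is the bare [x] on the right, outside any [Rpower]. *)
rewrite <- h at 3.
field; lra.
Qed.

(** As the base is below 1, [t => Rpower (/ 2) t] is strictly decreasing with value [/ 2] at
    [t = 1], so numerator and denominator change sign together at [q = 1]. *)
Lemma Rpower_half_sub_half_sign (q : R) : q <> 1 ->
  0 < (1 - q) / (Rpower (/ 2) q - / 2).
Proof.
intros hq.
assert (h1 : Rpower (/ 2) 1 = / 2) by (apply Rpower_1; lra).
assert (hln : ln (/ 2) < 0).
{ rewrite <- ln_1; apply ln_increasing; lra. }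
assert (hdecr : forall a b, a < b -> Rpower (/ 2) b < Rpower (/ 2) a).
{ intros a b hab; unfold Rpower; apply exp_increasing; nra. }
destruct (Rlt_or_le q 1) as [lt_q1 | le_1q].
- apply Rdiv_pos_pos; [lra |].
  specialize (hdecr q 1 lt_q1); lra.
- apply Rdiv_neg_neg; [lra |].
  assert (lt_1q : 1 < q) by lra.
  specialize (hdecr 1 q lt_1q); lra.
Qed.

Theorem corollary3p3 (q : R) (f : R -> R)
  (hq0 : 0 < q) (hq1 : q <> 1)
  (hdiff : differentiable_on f Ioc01)
  (hnonneg : forall x : R, Ioc01 x -> 0 <= f x)
  (hfun : forall x y : R, Ioc01 x -> Ioc01 y ->
            f (x * y) = Rpower x q * f y + y * f x) :
  exists c : R, 0 <= c /\
    forall x : R, Ioc01 x -> f x = - c * Rpower x q * lnq q x.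
Proof.
assert (hhalf : Ioc01 (/ 2)) by (split; lra).
pose proof (Rpower_half_sub_half_sign q hq1) as hsign.
assert (hne : Rpower (/ 2) q - / 2 <> 0).
(* Since [/ 0 = 0], a vanishing denominator would make the positive quotient in [hsign] zero. *)
{ intros h0; unfold Rdiv in hsign.
  rewrite h0, Rinv_0, Rmult_0_r in hsign; lra. }
(* The factor [1 - q] cancels the denominator of [lnq]. *)
exists (f (/ 2) * ((1 - q) / (Rpower (/ 2) q - / 2))); split.
- apply Rmult_le_pos; [now apply hnonneg | lra].
- intros x hx.
  rewrite Rmult_assoc, Rpower_lnq by (trivial; apply hx).
  assert (hsym : f x * (Rpower (/ 2) q - / 2) = f (/ 2) * (Rpower x q - x)).
  { pose proof (hfun (/ 2) x hhalf hx) as h.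
    (* [h] now equates both expansions of [f (x * / 2)]. *)
    rewrite Rmult_comm, (hfun x (/ 2) hx hhalf) in h; lra. }
  apply (Rmult_eq_reg_r (Rpower (/ 2) q - / 2)); [| exact hne].
  rewrite hsym.
  field; split; lra.
Qed.
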